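(* Let $\mathrm{CTL}_\pm$, $\mathrm{PastCTL}_\pm$, $\mathrm{PastCTL}$ and $\mathrm{CTL}$ be the temporal logics defined in the context. Then $\mathrm{CTL}_\pm \subseteq \mathrm{PastCTL}_\pm \subseteq \mathrm{PastCTL}$ (syntactically), and moreover: (1) $\mathrm{CTL}_\pm$ is strictly less expressive than $\mathrm{PastCTL}_\pm$; (2) $\mathrm{PastCTL}_\pm$ and $\mathrm{CTL}$ are incomparable in expressive power; (3) $\mathrm{PastCTL}_\pm$ is strictly less expressive than $\mathrm{PastCTL}$.
   Context: Fix a finite set $AP$ of atomic propositions and $\Sigma=2^{AP}$. A $\Sigma$-tree is a tree that is unranked (each node has finitely many children), unordered and leafless (each node has at least one child), with a labelling $t(v)\in\Sigma$ of each node $v$. A path is a finite or infinite sequence of nodes, each (after the first) a child of the previous one. $\mathrm{PastCTL}^*$: state formulae $\varphi ::= p \mid \neg\varphi \mid \varphi\lor\varphi \mid \mathsf{D}^n\varphi \mid \mathsf{E}\psi$ and path formulae $\psi ::= \varphi \mid \neg\psi \mid \psi\lor\psi \mid \mathsf{X}\psi \mid \mathsf{Y}\psi \mid \psi\,\mathsf{U}\,\psi \mid \psi\,\mathsf{R}\,\psi \mid \psi\,\mathsf{S}\,\psi$ ($p\in AP$, $n\ge 1$). Semantics on a pointed tree $(t,u)$: $p$ holds iff $p\in t(u)$; Booleans as usual; $\mathsf{D}^n\varphi$ holds iff $u$ has at least $n$ distinct children satisfying $\varphi$; $\mathsf{E}\psi$ holds iff there is an infinite path $\pi$ starting at the root of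 $t$ with $\pi(i)=u$ for some $i$ and $(t,\pi,i)\models\psi$. On $(t,\pi,i)$: a state formula holds iff it holds at $(t,\pi(i))$; $\mathsf{X}\psi$ iff $(t,\pi,i+1)\models\psi$; $\mathsf{Y}\psi$ iff $i>0$ and $(t,\pi,i-1)\models\psi$; $\psi_1\mathsf{U}\psi_2$ iff some $j\ge i$ has $\psi_2$ at $j$ and $\psi_1$ at all $k\in[i,j)$; $\psi_1\mathsf{R}\psi_2$ iff $\psi_2$ holds at all $j\ge i$, or some $j\ge i$ has $\psi_1\land\psi_2$ at $j$ and $\psi_2$ at all $k\in[i,j)$; $\psi_1\mathsf{S}\psi_2$ iff some $j\le i$ has $\psi_2$ at $j$ and $\psi_1$ at all $k\in(j,i]$. $\mathrm{PastCTL}$ is the fragment of $\mathrm{PastCTL}^*$ in which every future temporal operator ($\mathsf{X},\mathsf{U},\mathsf{R}$) is immediately preceded by the path quantifier $\mathsf{E}$. $\mathrm{CTL}$ is the fragment of $\mathrm{PastCTL}$ without the past operators $\mathsf{Y},\mathsf{S}$. $\mathrm{PastCTL}_\pm$ is given by the grammar $\varphi ::= p \mid \neg\varphi\mid\varphi\lor\varphi\mid \mathsf{D}^n\varphi\mid \mathsf{E}\mathsf{X}\varphi\mid \mathsf{E}(\varphi\,\mathsf{U}\,\varphi)\mid \mathsf{E}\mathsf{Y}\varphi\mid\mathsf{E}(\varphi\,\mathsf{S}\,\varphi)$ (with the $\mathrm{PastCTL}^*$ semantics), and $\mathrm{CTL}_\pm$ is its fragment without $\mathsf{E}\mathsf{Y}$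 and $\mathsf{E}\mathsf{S}$. A tree $t$ is a model of a state formula $\varphi$ if $\varphi$ holds at the root of $t$; two state formulae are initially equivalent if they have the same models. A logic $L_1$ is strictly less expressive than $L_2$ if every formula of $L_1$ can be effectively translated into an initially equivalent formula of $L_2$ but not vice versa; $L_1$ and $L_2$ are incomparable if some formula of $L_1$ has no initially equivalent formula in $L_2$ and some formula of $L_2$ has no initially equivalent formula in $L_1$. *)

(* Defs.v *)
From mathcomp Require Import all_boot.
Set Implicit Arguments. Unset Strict Implicit. Unset Printing Implicit Defensive.

Section PastCTL.
Variable AP : finType.

(* A Sigma-tree (Sigma = 2^AP), unranked, unordered, leafless.  Nodes are
   addresses [seq nat]: the root is [::], and the children of a node w are
   [rcons w c] for c < arity w.  Every node has arity >= 1 (leafless) and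
   finitely many children.  The order of children is irrelevant for the
   semantics (D^n only counts children), so this represents unordered trees. *)
Record tree := Tree {
  arity : seq nat -> nat;
  lab : seq nat -> {set AP};
  arity_pos : forall w, 0 < arity w }.

Definition root_path (t : tree) (pi : nat -> seq nat) : Prop :=
  pi 0 = [::] /\
  forall i, exists2 c, c < arity t (pi i) & pi i.+1 = rcons (pi i) c.

(* PastCTL* syntax: state formulae and path formulae.
   [SD n f] stands for D^(n+1) f, so that the index is >= 1 as in the paper. *)
Inductive sform : Type :=
  | SAtom of AP
  | SNeg of sform
  | SOr of sform & sform
  | SD of nat & sform
  | SE of pform
with pform : Type :=
  | PState of sform
  | PNeg of pform
  | POr of pform & pform
  | PX of pform
  | PY of pform
  | PU of pform & pform
  | PR of pform & pform
  | PS of pform & pform.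

Fixpoint ssat (t : tree) (u : seq nat) (f : sform) {struct f} : Prop :=
  match f with
  | SAtom p => p \in lab t u
  | SNeg f1 => ~ ssat t u f1
  | SOr f1 f2 => ssat t u f1 \/ ssat t u f2
  | SD n f1 => exists s : seq nat,
      [/\ uniq s, size s = n.+1 &
          forall c, c \in s -> c < arity t u /\ ssat t (rcons u c) f1]
  | SE g => exists pi, root_path t pi /\ exists i, pi i = u /\ psat t pi i g
  end
with psat (t : tree) (pi : nat -> seq nat) (i : nat) (g : pform) {struct g}
  : Prop :=
  match g with
  | PState f => ssat t (pi i) f
  | PNeg g1 => ~ psat t pi i g1
  | POr g1 g2 => psat t pi i g1 \/ psat t pi i g2
  | PX g1 => psat t pi i.+1 g1
  | PY g1 => 0 < i /\ psat t pi i.-1 g1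
  | PU g1 g2 => exists2 j, i <= j &
      psat t pi j g2 /\ forall k, i <= k < j -> psat t pi k g1
  | PR g1 g2 => (forall j, i <= j -> psat t pi j g2) \/
      exists2 j, i <= j &
        [/\ psat t pi j g1, psat t pi j g2 &
            forall k, i <= k < j -> psat t pi k g2]
  | PS g1 g2 => exists2 j, j <= i &
      psat t pi j g2 /\ forall k, j < k <= i -> psat t pi k g1
  end.

Definition init_equiv (f g : sform) : Prop :=
  forall t : tree, ssat t [::] f <-> ssat t [::] g.

Fixpoint is_ctlpm (past : bool) (f : sform) : bool :=
  match f with
  | SAtom _ => true
  | SNeg f1 => is_ctlpm past f1
  | SOr f1 f2 => is_ctlpm past f1 && is_ctlpm past f2
  | SD _ f1 => is_ctlpm past f1
  | SE (PX (PState f1)) => is_ctlpm past f1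
  | SE (PU (PState f1) (PState f2)) => is_ctlpm past f1 && is_ctlpm past f2
  | SE (PY (PState f1)) => past && is_ctlpm past f1
  | SE (PS (PState f1) (PState f2)) =>
      [&& past, is_ctlpm past f1 & is_ctlpm past f2]
  | _ => false
  end.

(* PastCTL (past = true) and CTL (past = false): every future operator
   X, U, R is immediately preceded by E.  [nofut] checks a path formula
   containing no future operator at its top level (only Booleans, and Y, S
   when past = true), whose state subformulae are again in the logic. *)
Fixpoint is_pctl (past : bool) (f : sform) : bool :=
  let fix nofut (g : pform) : bool :=
    match g with
    | PState f1 => is_pctl past f1
    | PNeg g1 => nofut g1
    | POr g1 g2 => nofut g1 && nofut g2
    | PY g1 => past && nofut g1
    | PS g1 g2 => [&& past, nofut g1 & nofut g2]
    | _ => false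
    end in
  match f with
  | SAtom _ => true
  | SNeg f1 => is_pctl past f1
  | SOr f1 f2 => is_pctl past f1 && is_pctl past f2
  | SD _ f1 => is_pctl past f1
  | SE (PX g1) => nofut g1
  | SE (PU g1 g2) => nofut g1 && nofut g2
  | SE (PR g1 g2) => nofut g1 && nofut g2
  | SE g => nofut g
  end.

Definition CTLpm := is_ctlpm false.
Definition PastCTLpm := is_ctlpm true.
Definition PastCTL := is_pctl true.
Definition CTL := is_pctl false.

Definition strictly_less (L1 L2 : sform -> bool) : Prop :=
  (exists tr : sform -> sform,
      forall f, L1 f -> L2 (tr f) /\ init_equiv f (tr f)) /\
  (exists g, L2 g /\ forall f, L1 f -> ~ init_equiv f g).

Definition incomparable (L1 L2 : sform -> bool) : Prop :=
  (exists f, L1 f /\ forall g, L2 g -> ~ init_equiv f g) /\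
  (exists g, L2 g /\ forall f, L1 f -> ~ init_equiv g f).

End PastCTL.

(* Main.v *)
Require Import Defs.
From mathcomp Require Import all_boot.
From mathcomp Require Import zify.
From Stdlib Require Import Classical ClassicalEpsilon.
Set Implicit Arguments. Unset Strict Implicit. Unset Printing Implicit Defensive.

(**
Two formulae separate the logics.

The PastCTL± formula "some node with a single child is reached along a path on
which [p0] alternates" is not expressible in CTL.  Take unfoldings of a graph in
which every move keeps or flips the colour and uses up fuel, and in which the
sinks with one child are reachable either from a good state or after a move that
keeps the colour.  By induction on the formula, a CTL formula with enough fuel
left sees only the colour: it cannot link the colour of a node to that of its
predecessor on the path, so a path to a sink can be imitated from a bad state by
first wasting a move.

The CTL formula EG [p0] is not expressible in PastCTL±.  Compare the binary tree
in which [p0] holds at depth < M with the one in which it holds at distance < M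
from the leftmost branch.  By induction on the formula, truth at a node depends
only on its height and on its distance to the frontier of [p0], both up to a
constant K: since and until are insensitive to stuttering, and the infinite
branch on which [p0] holds has no visible finite part.
*)

Scheme sform_pform_ind := Induction for sform Sort Prop
  with pform_sform_ind := Induction for pform Sort Prop.

(** * The E-quantified operators evaluated at a node, without paths *)

Section Tree.
Variables (AP : finType) (t : tree AP).
Implicit Types (u v w : seq nat) (P Q X : seq nat -> Prop) (g : pform AP).

Inductive node : seq nat -> Prop :=
  | node_root : node [::]
  | node_child w c : node w -> c < arity t w -> node (rcons w c).

Lemma node_rcons w c : node (rcons w c) -> node w /\ c < arity t w.
Proof.
move=> H; inversion H as [E|w' c' Hw Hc E]; first by case: w {H} E.
by case/rcons_inj: E => <- <-.
Qed.

Lemma root_path_size pi i : root_path t pi -> size (pi i) = i.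
Proof.
case=> p0 pS; elim: i => [|i IH]; first by rewrite p0.
by have [c _ ->] := pS i; rewrite size_rcons IH.
Qed.

Lemma root_path_node pi i : root_path t pi -> node (pi i).
Proof.
case=> p0 pS; elim: i => [|i IH]; first by rewrite p0; exact: node_root.
by have [c lc ->] := pS i; apply: node_child.
Qed.

Lemma root_path_parent pi i u c :
  root_path t pi -> pi i.+1 = rcons u c -> pi i = u.
Proof. by case=> _ pS; have [d _ ->] := pS i; case/rcons_inj. Qed.

(** Extends the path from the root to [u] by the strategy [F]. In the induction [F] is overridden at
    the parent so as to enter [u]; later nodes are all longer than the parent, so the override is
    not met again. *)
Lemma root_path_through u (F : seq nat -> nat) :
    node u -> (forall v, F v < arity t v) ->
  exists2 pi, root_path t pi &
    forall k, pi (size u + k) = iter k (fun v => rcons v (F v)) u.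
Proof.
move=> nu; elim: nu F => [|w c nw IH lc] F HF.
  exists (fun k => iter k (fun v => rcons v (F v)) [::]) => //.
  by split=> // i; exists (F (iter i (fun v => rcons v (F v)) [::])).
have [|pi rp E] := IH (fun v => if v == w then c else F v).
  by move=> v; case: eqP => [->|].
exists pi => // k; rewrite size_rcons addSnnS E iterSr eqxx.
suff [] : iter k (fun v => rcons v (if v == w then c else F v)) (rcons w c) =
          iter k (fun v => rcons v (F v)) (rcons w c) /\
          size w < size (iter k (fun v => rcons v (F v)) (rcons w c)) by [].
elim: k => [|k [IHe IHs]] /=; first by rewrite size_rcons.
rewrite IHe size_rcons; split; last by apply: leqW.
by case: eqP IHs => // ->; rewrite ltnn.
Qed.

Lemma root_path_exists u :
  node u -> exists2 pi, root_path t pi & pi (size u) = u.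
Proof.
move=> nu; have [|pi rp E] := @root_path_through u (fun=> 0) nu.
  by move=> v; exact: arity_pos.
by exists pi => //; have := E 0; rewrite addn0.
Qed.

Definition depends_on_node g P :=
  forall pi i, root_path t pi -> (psat t pi i g <-> P (pi i)).

Lemma ssat_E g P u : depends_on_node g P ->
  (ssat t u (SE g) <-> node u /\ P u).
Proof.
move=> gP; split=> [[pi [rp [i [<- H]]]]|[nu Pu]].
  by split; [exact: root_path_node | apply/gP].
have [pi rp E] := root_path_exists nu.
by exists pi; split=> //; exists (size u); split=> //; apply/gP; rewrite ?E.
Qed.

Lemma ssat_EX g P u : depends_on_node g P ->
  (ssat t u (SE (PX g)) <->
   node u /\ exists2 c, c < arity t u & P (rcons u c)).
Proof.
move=> gP; split=> [[pi [rp [i [<- /= H]]]]|[nu [c lc Pu]]].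
  split; first exact: root_path_node.
  by have [c lc E] := rp.2 i; exists c => //; rewrite -E; apply/gP.
have [pi rp E] := root_path_exists (node_child nu lc).
rewrite size_rcons in E.
exists pi; split=> //; exists (size u); split.
  exact: root_path_parent rp E.
by apply/gP => //; rewrite E.
Qed.

Lemma ssat_EY g P u : depends_on_node g P ->
  (ssat t u (SE (PY g)) <->
   node u /\ exists w c, u = rcons w c /\ P w).
Proof.
move=> gP; split=> [[pi [rp [i [<- /= [i0 H]]]]]|[nu [w [c [Eu Pw]]]]].
  split; first exact: root_path_node.
  case: i i0 H => // i _ /= H.
  by have [c lc E] := rp.2 i; exists (pi i), c; split=> //; apply/gP.
have [pi rp E] := root_path_exists nu.
exists pi; split=> //; exists (size u); split=> //.
move: E; rewrite Eu size_rcons => E /=; split=> //; apply/gP => //.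
by rewrite (root_path_parent rp E).
Qed.

Inductive reach P Q : seq nat -> Prop :=
  | reach_here u : Q u -> reach P Q u
  | reach_child u c :
      P u -> c < arity t u -> reach P Q (rcons u c) -> reach P Q u.

Lemma reach_inv P Q u : reach P Q u ->
  Q u \/ P u /\ exists2 c, c < arity t u & reach P Q (rcons u c).
Proof. by case=> [v|v c]; [left | right; split=> //; exists c]. Qed.

Lemma reach_path P Q u : reach P Q u -> node u ->
  exists2 pi, root_path t pi & pi (size u) = u /\
    exists2 j, size u <= j & Q (pi j) /\
      forall k, size u <= k < j -> P (pi k).
Proof.
elim=> [{}u Qu nu|{}u c Pu lc _ IH nu].
  have [pi rp E] := root_path_exists nu.
  exists pi => //; split=> //; exists (size u) => //; rewrite E.
  by split=> // k; rewrite ltnNge andbN.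
have [pi rp] := IH (node_child nu lc); rewrite size_rcons.
move=> [E [j lj [Qj Pk]]]; have Eu := root_path_parent rp E.
exists pi => //; split=> //; exists j; first exact: ltnW.
split=> // k /andP[]; rewrite leq_eqVlt => /orP[/eqP <- _|lk kj].
  by rewrite Eu.
by apply: Pk; rewrite lk kj.
Qed.

Lemma ssat_EU g1 g2 P Q u : depends_on_node g1 P -> depends_on_node g2 Q ->
  (ssat t u (SE (PU g1 g2)) <-> node u /\ reach P Q u).
Proof.
move=> gP gQ; split=> [[pi [rp [i [<- /= [j lij [Hj Hk]]]]]]|[nu ru]].
  split; first exact: root_path_node.
  suff H n k : n + k = j -> (forall l, k <= l < j -> psat t pi l g1) ->
      reach P Q (pi k) by apply: H Hk; exact: subnK lij.
  elim: n k => [|n IH] k.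
    by rewrite add0n => -> _; apply: reach_here; apply/gQ.
  rewrite addSnnS => E Pk; have [c lc Ec] := rp.2 k.
  apply: (@reach_child _ _ _ c) => //; last first.
    by rewrite -Ec; apply: IH => // l lk; apply: Pk; lia.
  by apply/gP => //; apply: Pk; lia.
have [pi rp [E [j lj [Qj Pk]]]] := reach_path ru nu.
exists pi; split=> //; exists (size u); split=> //=; exists j => //.
by split=> [|k lk]; [apply/gQ | apply/gP => //; apply: Pk].
Qed.

Inductive since P Q : seq nat -> Prop :=
  | since_here u : Q u -> since P Q u
  | since_parent u c : P (rcons u c) -> since P Q u -> since P Q (rcons u c).

Lemma since_inv P Q u : since P Q u ->
  Q u \/ P u /\ exists w c, u = rcons w c /\ since P Q w.
Proof. by case=> [v|v c]; [left | right; split=> //; exists v, c]. Qed.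

Lemma ssat_ES g1 g2 P Q u : depends_on_node g1 P -> depends_on_node g2 Q ->
  (ssat t u (SE (PS g1 g2)) <-> node u /\ since P Q u).
Proof.
move=> gP gQ; split=> [[pi [rp [i [<- /= [j lji [Hj Hk]]]]]]|[nu su]].
  split; first exact: root_path_node.
  elim: i lji Hk => [|i IH] lji Hk.
    have j0 : j = 0 by lia.
    by apply: since_here; apply/gQ; rewrite -?j0.
  case: (ltngtP j i.+1) lji => // [lt _|<- _]; last first.
    by apply: since_here; apply/gQ.
  have Pi : P (pi i.+1) by apply/gP => //; apply: Hk; lia.
  have [c lc Ec] := rp.2 i; rewrite Ec in Pi *.
  apply: since_parent => //; apply: IH => // k lk; apply: Hk; lia.
have [pi rp E] := root_path_exists nu.
exists pi; split=> //; exists (size u); split=> //=.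
elim: su E {nu} => [{}u Qu E|{}u c Pu _ IH E].
  exists (size u) => //; split; first by apply/gQ; rewrite ?E.
  by move=> k; lia.
move: (E); rewrite size_rcons => E'.
have [j lj [Qj Pk]] := IH (root_path_parent rp E').
exists j; first exact: leqW.
split=> // k; case: (ltngtP k (size u).+1) => [lk|lk|->] Hk; last 1 first.
- by apply/gP; rewrite ?E'.
- by apply: Pk; lia.
- by lia.
Qed.

(** A greatest fixpoint, witnessed by a set [X] closed under the unfolding rule, so that infinite
    runs need no coinductive type. *)
Inductive release P Q u : Prop :=
  Release X of X u & (forall v, X v ->
    Q v /\ (P v \/ exists2 c, c < arity t v & X (rcons v c))).

Lemma release_inv P Q u : release P Q u ->
  (P u /\ Q u) \/ Q u /\ exists2 c, c < arity t u & release P Q (rcons u c).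
Proof.
case=> X Xu HX; have [Qu [Pu|[c lc Xc]]] := HX _ Xu; first by left.
by right; split=> //; exists c => //; exists X.
Qed.

Lemma release_here P Q u : P u /\ Q u -> release P Q u.
Proof. by case=> Pu Qu; exists (eq u) => // v <-; split=> //; left. Qed.

Lemma release_child P Q u c :
  Q u -> c < arity t u -> release P Q (rcons u c) -> release P Q u.
Proof.
move=> Qu lc [X Xu HX]; exists (fun v => v = u \/ X v); first by left.
move=> v [->|/HX [Qv [Pv|[d ld Xd]]]].
- by split=> //; right; exists c => //; right.
- by split=> //; left.
- by split=> //; right; exists d => //; right.
Qed.

Lemma release_path P Q u : release P Q u -> node u ->
  exists2 pi, root_path t pi & pi (size u) = u /\
    ((forall j, size u <= j -> Q (pi j)) \/
     exists2 j, size u <= j &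
       [/\ P (pi j), Q (pi j) & forall k, size u <= k < j -> Q (pi k)]).
Proof.
case=> X Xu HX nu.
have next v : exists c, c < arity t v /\ (X v -> ~ P v -> X (rcons v c)).
  case: (classic (X v)) => Xv; last by exists 0; split=> //; exact: arity_pos.
  have [_ [Pv|[c lc Xc]]] := HX _ Xv; last by exists c.
  by exists 0; split=> //; exact: arity_pos.
pose F v := proj1_sig (constructive_indefinite_description _ (next v)).
have FP v : F v < arity t v /\ (X v -> ~ P v -> X (rcons v (F v))).
  exact: proj2_sig (constructive_indefinite_description _ (next v)).
have [|pi rp E] := @root_path_through u F nu; first by move=> v; case: (FP v).
exists pi => //; split; first by have := E 0; rewrite addn0.
(* The chosen successors stay in [X] until [P] is met. So either [P] and [Q] meet on this path, or
   the path stays in [X], hence in [Q], for ever. *)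
case: (classic (exists2 j, size u <= j &
  [/\ P (pi j), Q (pi j) & forall k, size u <= k < j -> Q (pi k)]));
  [by right | move=> nP; left].
suff XQ n : X (pi (size u + n)) /\
    forall k, size u <= k < size u + n -> Q (pi k).
  by move=> j lj; rewrite -(subnKC lj); case: (HX _ (XQ (j - size u)).1).
elim: n => [|n [Xn Qn]]; first by rewrite E; split=> // k; lia.
have [Qv _] := HX _ Xn; split.
  rewrite E iterS -E; apply: (FP _).2 => // Pv.
  by apply: nP; exists (size u + n) => //; exact: leq_addr.
move=> k; rewrite addnS ltnS => /andP[lk].
rewrite leq_eqVlt => /orP[/eqP -> //|lt]; apply: Qn; lia.
Qed.

Lemma ssat_ER g1 g2 P Q u : depends_on_node g1 P -> depends_on_node g2 Q ->
  (ssat t u (SE (PR g1 g2)) <-> node u /\ release P Q u).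
Proof.
move=> gP gQ; split=> [[pi [rp [i [<- H]]]]|[nu ru]].
  split; first exact: root_path_node.
  exists (fun v => exists2 k, pi k = v & psat t pi k (PR g1 g2)).
    by exists i.
  move=> v [k <- /= [Hk|[j lj [Pj Qj Hk]]]].
    split; first by apply/gQ => //; apply: Hk.
    have [c lc E] := rp.2 k; right; exists c => //; exists k.+1 => //.
    by left=> j lj; apply: Hk; exact: ltnW.
  move: lj; rewrite leq_eqVlt => /orP[/eqP ->|lj].
    by split; [apply/gQ | left; apply/gP].
  split; first by apply/gQ => //; apply: Hk; rewrite leqnn.
  have [c lc E] := rp.2 k; right; exists c => //; exists k.+1 => //.
  right; exists j => //; split=> // l ll; apply: Hk; lia.
have [pi rp [E H]] := release_path ru nu.
exists pi; split=> //; exists (size u); split=> //=.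
case: H => [H|[j lj [Pj Qj Hk]]]; [left=> j lj | right; exists j => //].
  by apply/gQ => //; apply: H.
by split; [apply/gP | apply/gQ | move=> k lk; apply/gQ => //; apply: Hk].
Qed.

End Tree.

(** * Trees as unfoldings of transition systems *)

Section Unfold.
Variables (AP : finType) (S : Type) (step : S -> nat -> S) (ar : S -> nat).
Variables (lb : S -> {set AP}) (ar_gt0 : forall s, 0 < ar s).

Definition unfold (s : S) : tree AP :=
  @Tree AP (fun w => ar (foldl step s w)) (fun w => lb (foldl step s w))
    (fun w => ar_gt0 (foldl step s w)).

End Unfold.

(** * Induction over the fragments and their syntactic inclusions *)

Section Formulas.
Variable AP : finType.
Implicit Types (f : sform AP) (g : pform AP).

Definition STrue (p : AP) : sform AP := SOr (SAtom p) (SNeg (SAtom p)).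
Definition SAnd f1 f2 : sform AP := SNeg (SOr (SNeg f1) (SNeg f2)).

Lemma ssat_True t u p : ssat t u (STrue p).
Proof. exact: classic. Qed.

Lemma ssat_Or t u f1 f2 : ssat t u (SOr f1 f2) <-> ssat t u f1 \/ ssat t u f2.
Proof. by []. Qed.

Lemma ssat_And t u f1 f2 : ssat t u (SAnd f1 f2) <-> ssat t u f1 /\ ssat t u f2.
Proof.
rewrite /=; split=> [H|[H1 H2] []//].
by split; apply: NNPP => H'; apply: H; [left | right].
Qed.

Lemma PState_node t f : depends_on_node t (PState f) (fun u => ssat t u f).
Proof. by []. Qed.

(* [past] is bound outside the [fix] to make this convertible to the local
   fixpoint of [is_pctl]. *)
Definition nofut (past : bool) := fix nofut (g : pform AP) : bool :=
  match g with
  | PState f1 => is_pctl past f1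
  | PNeg g1 => nofut g1
  | POr g1 g2 => nofut g1 && nofut g2
  | PY g1 => past && nofut g1
  | PS g1 g2 => [&& past, nofut g1 & nofut g2]
  | _ => false
  end.

(* The state predicate defined by a path formula of CTL; the value on formulae
   with a temporal operator is junk. *)
Fixpoint bsat (t : tree AP) g (u : seq nat) : Prop :=
  match g with
  | PState f => ssat t u f
  | PNeg g1 => ~ bsat t g1 u
  | POr g1 g2 => bsat t g1 u \/ bsat t g2 u
  | _ => False
  end.

Lemma bsatP t g : nofut false g -> depends_on_node t g (bsat t g).
Proof.
elim: g => //= [g1 IH /IH H pi i rp|g1 IH1 g2 IH2 /andP[/IH1 H1 /IH2 H2] pi i rp].
  by have := H pi i rp => /=; tauto.
by have := H1 pi i rp; have := H2 pi i rp => /=; tauto.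
Qed.

Lemma ctlpm_ind (past : bool) (P : sform AP -> Prop) :
    (forall p, P (SAtom p)) ->
    (forall f, P f -> P (SNeg f)) ->
    (forall f1 f2, P f1 -> P f2 -> P (SOr f1 f2)) ->
    (forall n f, P f -> P (SD n f)) ->
    (forall f, P f -> P (SE (PX (PState f)))) ->
    (forall f1 f2, P f1 -> P f2 -> P (SE (PU (PState f1) (PState f2)))) ->
    (forall f, past -> P f -> P (SE (PY (PState f)))) ->
    (forall f1 f2, past -> P f1 -> P f2 ->
       P (SE (PS (PState f1) (PState f2)))) ->
  forall f, is_ctlpm past f -> P f.
Proof.
move=> Hatom Hneg Hor HD HX HU HY HS.
pose Pf f := is_ctlpm past f -> P f.
(* A path formula carries two claims, one for the state formula under [PState] and one for [SE g],
   because [is_ctlpm] looks two constructors below [SE]. *)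
pose Pg g := (if g is PState f then Pf f else True) /\ Pf (SE g).
apply: (@sform_pform_ind AP Pf Pg); rewrite /Pg /Pf //=.
- by move=> f IH /IH; apply: Hneg.
- by move=> f1 IH1 f2 IH2 /andP[/IH1 ? /IH2]; apply: Hor.
- by move=> n f IH /IH; apply: HD.
- by move=> g [].
- by move=> [] //= f [IH _]; split=> // /IH; apply: HX.
- by move=> [] //= f [IH _]; split=> // /andP[? /IH]; apply: HY.
- move=> [] //= f1 [IH1 _] [] //= f2 [IH2 _]; split=> // /andP[/IH1 ? /IH2].
  exact: HU.
- move=> [] //= f1 [IH1 _] [] //= f2 [IH2 _]; split=> // /and3P[? /IH1 ? /IH2].
  exact: HS.
Qed.

Lemma ctlpm_pctl past f : is_ctlpm past f -> is_pctl past f.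
Proof.
elim/ctlpm_ind: f / => //= [f1 f2 -> -> //|f1 f2 -> -> //|f -> ->//|].
by move=> f1 f2 -> -> ->.
Qed.

Lemma ctlpm_past f : is_ctlpm false f -> is_ctlpm true f.
Proof. by elim/ctlpm_ind: f / => //= f1 f2 -> ->. Qed.

End Formulas.

(** * A PastCTL± property that CTL cannot express *)

Section Alternation.
Variables (AP : finType) (p0 : AP).

(* Moves 0 and 1 keep the colour and choose [good] freely; moves 2 and 3 flip it
   and cannot make a bad state good.  Only the arity of a sink reveals [good]. *)
Record cstate := CState { good : bool; colour : bool; fuel : nat }.

Definition cstep (s : cstate) (c : nat) : cstate :=
  if fuel s is d.+1
  then CState (odd c && (good s || (c < 2))) (colour s (+) (2 <= c)) d
  else s.

Definition carity (s : cstate) : nat :=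
  if fuel s is _.+1 then 4 else if good s then 1 else 2.

Definition clab (s : cstate) : {set AP} := if colour s then [set p0] else set0.

Lemma carity_gt0 s : 0 < carity s.
Proof. by rewrite /carity; case: (fuel s) => //; case: (good s). Qed.

Definition ctree := unfold cstep clab carity_gt0.

Definition cnode (s : cstate) (w : seq nat) := foldl cstep s w.

Lemma cnode_rcons s w c : cnode s (rcons w c) = cstep (cnode s w) c.
Proof. by rewrite /cnode foldl_rcons. Qed.

Definition csim N (s s' : cstate) :=
  colour s = colour s' /\ ((N <= fuel s /\ N <= fuel s') \/ s = s').

Lemma csimW N N' s s' : N <= N' -> csim N' s s' -> csim N s s'.
Proof.
move=> le [E [[l1 l2]|E']]; split=> //; last by right.
by left; split; apply: leq_trans le _.
Qed.

Definition node_pred := cstate -> seq nat -> Prop.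

(** One implication suffices, since the relations used are symmetric. The roots vary too, so an
    invariant [P] cannot see the history of a node. *)
Definition invariant (R : cstate -> cstate -> Prop) (P : node_pred) :=
  forall s w s' w', node (ctree s) w -> node (ctree s') w' ->
    R (cnode s w) (cnode s' w') -> P s w -> P s' w'.

Lemma invariantW N N' P : N <= N' -> invariant (csim N) P -> invariant (csim N') P.
Proof. by move=> le iP s w s' w' n n' /(csimW le); apply: iP. Qed.

Lemma invariant_eq N P : invariant (csim N) P -> invariant eq P.
Proof.
by move=> iP s w s' w' n n' E; apply: iP => //; rewrite E; split=> //; right.
Qed.

Lemma csim_sym N s s' : csim N s s' -> csim N s' s.
Proof. by case=> E [[]|->]; split=> //; [left | right]. Qed.

Lemma csim_child N s s' c : csim N.+1 s s' -> csim N (cstep s c) (cstep s' c).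
Proof.
case=> E [[l l']|->]; last by split=> //; right.
rewrite /cstep; case: (fuel s) l => // d l; case: (fuel s') l' => // d' l'.
by split; rewrite /= ?E //; left.
Qed.

Lemma csim_arity N s s' : 0 < N -> csim N s s' -> carity s = carity s'.
Proof.
move=> N0 [E [[l l']|->//]]; rewrite /carity.
by case: (fuel s) l; case: (fuel s') l' => //; case: N N0.
Qed.

(* [F] is a fixpoint of the until or release kind.  From a node with much fuel
   one can reach in colour-preserving moves any state of that colour with fuel
   [N], including a good one. *)
Lemma invariant_fixpoint N (A B F : node_pred) :
    0 < N -> invariant (csim N) A -> invariant (csim N) B ->
    (forall s w, F s w -> B s w \/ A s w /\
       exists2 c, c < carity (cnode s w) & F s (rcons w c)) ->
    (forall s w, B s w -> F s w) ->
    (forall s w c, A s w -> c < carity (cnode s w) -> F s (rcons w c) ->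
       F s w) ->
    invariant eq F ->
  invariant (csim N.+2) F.
Proof.
move=> N0 iA iB Finv FB FA Feq.
have arity4 s : N <= fuel s -> carity s = 4.
  by move=> l; rewrite /carity; have := leq_trans N0 l; case: (fuel s).
have high s w s' w' P : invariant (csim N) P ->
    node (ctree s) w -> node (ctree s') w' -> N <= fuel (cnode s w) ->
    N <= fuel (cnode s' w') -> colour (cnode s w) = colour (cnode s' w') ->
    P s w -> P s' w'.
  by move=> iP n n' l l' E; apply: iP => //; split=> //; left.
(* Follow a run of [F] down to fuel [N]. A [B] met at the colour of [w] already holds at [w], by
   similarity; what remains is a [B] at the other colour, or a run that arrives at fuel [N] with
   [A]. *)
have down d s w : node (ctree s) w -> fuel (cnode s w) = N + d -> F s w ->
    B s w \/ A s w /\ ((exists s' w', [/\ node (ctree s') w',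
        N <= fuel (cnode s' w'), colour (cnode s' w') = ~~ colour (cnode s w) &
        B s' w']) \/
      exists s' w', [/\ node (ctree s') w', fuel (cnode s' w') = N,
        A s' w' & F s' w']).
  elim: d w => [|d IH] w nw Ed Fw.
    have [Bw|[Aw _]] := Finv _ _ Fw; [by left | right; split=> //; right].
    by exists s, w; rewrite Ed addn0.
  have [Bw|[Aw [c lc Fc]]] := Finv _ _ Fw; [by left | ].
  have nc : node (ctree s) (rcons w c) by apply: node_child.
  have Efc : fuel (cnode s (rcons w c)) = N + d.
    by rewrite cnode_rcons /cstep Ed addnS.
  have Ecc : colour (cnode s (rcons w c)) = colour (cnode s w) (+) (2 <= c).
    by rewrite cnode_rcons /cstep Ed addnS.
  have [Bc|[Ac H]] := IH _ nc Efc Fc.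
    case: (2 <= c) Ecc => E; last first.
      left; apply: (high _ _ _ _ _ iB nc nw) Bc; rewrite ?Efc ?Ed ?leq_addr //.
      by rewrite E addbF.
    right; split=> //; left; exists s, (rcons w c).
    by rewrite Efc leq_addr E addbT.
  case: H => [[s' [w' [n' l' E' B']]]|H]; last by right; split=> //; right.
  have [E|E] := boolP (colour (cnode s' w') == colour (cnode s w)).
    left; apply: (high _ _ _ _ _ iB n' nw) B' => //; last exact/eqP.
    by rewrite Ed leq_addr.
  right; split=> //; left; exists s', w'; split=> //.
  by case: (colour (cnode s' w')) (colour (cnode s w)) E => [] [].
(* Conversely, a node of the same colour with more fuel reaches a state equal to that of [w] by
   colour-preserving moves; [A] holds on the way, as it sees only the colour. *)
have up d s w s' w' : node (ctree s) w -> node (ctree s') w' ->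
    fuel (cnode s w) = N -> fuel (cnode s' w') = N + d.+1 ->
    colour (cnode s w) = colour (cnode s' w') -> A s w -> F s w -> F s' w'.
  elim: d w' => [|d IH] w' nw nw' Ef Ef' Ec Aw Fw.
    (* Moves 0 and 1 keep the colour and set [good] to their parity, so this last move lands in the
       state of [w] itself. *)
    apply: (FA _ _ (good (cnode s w) : nat)).
    - by apply: high Aw => //; rewrite ?Ef ?Ef' ?leq_addr.
    - by rewrite arity4 ?Ef' ?leq_addr //; case: good.
    apply: (Feq s w) => //.
      apply: node_child => //=; rewrite -/(cnode _ _).
      by rewrite arity4 ?Ef' ?leq_addr //; case: good.
    rewrite cnode_rcons /cstep Ef' addn1.
    case: (cnode s w) Ec Ef => g x d /= -> ->.
    by case: g => /=; rewrite ?orbT addbF.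
  apply: (FA _ _ 0).
  - by apply: high Aw => //; rewrite ?Ef ?Ef' ?leq_addr.
  - exact: carity_gt0.
  apply: IH => //; rewrite ?cnode_rcons /cstep ?Ef' ?addnS //= ?addbF //.
  by apply: node_child => //; exact: carity_gt0.
move=> s w s' w' nw nw' [Ec [[l l']|E]] Fw; last exact: (Feq s w).
have [|Bw|[Aw H]] := down (fuel (cnode s w) - N) _ _ nw _ Fw.
- by rewrite subnKC //; lia.
- by apply: FB; apply: high Bw => //; lia.
have Aw' : A s' w' by apply: high Aw => //; lia.
(* Move 2 corrects a wrong colour. It spends one unit of fuel and [up] needs at least one more,
   whence [N.+2]. *)
have l2 : 2 < carity (cnode s' w') by rewrite arity4 //; lia.
have n2 : node (ctree s') (rcons w' 2) by apply: node_child.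
have Ef2 : fuel (cnode s' (rcons w' 2)) = (fuel (cnode s' w')).-1.
  by rewrite cnode_rcons /cstep; case: (fuel _) l'.
have Ec2 : colour (cnode s' (rcons w' 2)) = ~~ colour (cnode s w).
  by rewrite Ec cnode_rcons /cstep; case: (fuel _) l' => //= d _; rewrite addbT.
case: H => [[s1 [w1 [n1 l1 E1 B1]]]|[s1 [w1 [n1 l1 A1 F1]]]].
  apply: (FA _ _ 2) => //; apply: FB; apply: high B1 => //; first by lia.
  by rewrite E1 Ec2.
have [E|E] := boolP (colour (cnode s1 w1) == colour (cnode s w)).
  apply: (up (fuel (cnode s' w') - N.+1)) A1 F1 => //; first by lia.
  by rewrite (eqP E).
apply: (FA _ _ 2) => //.
apply: (up (fuel (cnode s' w') - N.+2)) A1 F1 => //; first by lia.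
by rewrite Ec2; case: (colour (cnode s1 w1)) (colour (cnode s w)) E => [] [].
Qed.

Lemma reach_invariant N (P Q : node_pred) :
    0 < N -> invariant (csim N) P -> invariant (csim N) Q ->
  invariant (csim N.+2) (fun s => reach (ctree s) (P s) (Q s)).
Proof.
move=> N0 iP iQ; apply: (invariant_fixpoint N0 iP iQ).
- by move=> s w; apply: reach_inv.
- by move=> s w; apply: reach_here.
- by move=> s w c Pw lc; apply: reach_child.
move=> s w s' w' nw nw' E H; elim: H w' nw nw' E => {w} [w Qw|w c Pw lc _ IH] w'.
  move=> nw nw' E; apply: reach_here.
  by apply: (invariant_eq iQ) Qw.
move=> nw nw' E; have lc' : c < arity (ctree s') w' by rewrite /= -/(cnode _ _) -E.
apply: (@reach_child _ _ _ _ _ c) => //.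
  by apply: (invariant_eq iP) Pw.
by apply: IH; [apply: node_child | apply: node_child | rewrite !cnode_rcons E].
Qed.

Lemma release_invariant N (P Q : node_pred) :
    0 < N -> invariant (csim N) P -> invariant (csim N) Q ->
  invariant (csim N.+2) (fun s => release (ctree s) (P s) (Q s)).
Proof.
move=> N0 iP iQ.
(* Release continues under [Q] and stops where [P] and [Q] both hold; these are the [A] and [B] of
   the fixpoint lemma. *)
have iPQ : invariant (csim N) (fun s w => P s w /\ Q s w).
  by move=> s w s' w' nw nw' E [Pw Qw]; split; [apply: iP Pw | apply: iQ Qw].
apply: (invariant_fixpoint N0 iQ iPQ).
- by move=> s w; apply: release_inv.
- by move=> s w; apply: release_here.
- by move=> s w c Qw lc; apply: release_child.
move=> s w s' w' nw nw' E [X Xw HX].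
exists (fun v' => exists v, [/\ X v, node (ctree s) v, node (ctree s') v' &
  cnode s v = cnode s' v']); first by exists w.
move=> v' [v [Xv nv nv' Ev]]; have [Qv H] := HX _ Xv; split.
  by apply: (invariant_eq iQ) Qv.
case: H => [Pv|[c lc Xc]]; first by left; apply: (invariant_eq iP) Pv.
have lc' : c < arity (ctree s') v' by rewrite /= -/(cnode _ _) -Ev.
right; exists c => //; exists (rcons v c).
by split=> //; [apply: node_child | apply: node_child | rewrite !cnode_rcons Ev].
Qed.

(** Induction on the formula: Booleans take the larger bound on the fuel, [SD] and EX add one unit,
    EU and ER add two. *)
Lemma ctl_invariant (f : sform AP) : is_pctl false f ->
  exists2 N, 0 < N & invariant (csim N) (fun s w => ssat (ctree s) w f).
Proof.
pose If f := exists2 N, 0 < N & invariant (csim N) (fun s w => ssat (ctree s) w f).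
pose Ig g := exists2 N, 0 < N & invariant (csim N) (fun s => bsat (ctree s) g).
pose Pf f := is_pctl false f -> If f.
pose Pg g := (nofut false g -> Ig g) /\ Pf (SE g).
have EI g : nofut false g -> Ig g -> If (SE g).
  move=> ng [N N0 H]; exists N => // s w s' w' nw nw' E.
  case/(ssat_E _ (bsatP ng)) => _ bw.
  by apply/(ssat_E _ (bsatP ng)); split=> //; apply: H bw.
have common g1 g2 : Ig g1 -> Ig g2 -> exists2 N, 0 < N &
    invariant (csim N) (fun s => bsat (ctree s) g1) /\
    invariant (csim N) (fun s => bsat (ctree s) g2).
  move=> [N1 l1 i1] [N2 l2 i2]; exists (maxn N1 N2); first by lia.
  by split; [apply: invariantW i1 | apply: invariantW i2]; lia.
move: f; apply: (@sform_pform_ind AP Pf Pg); rewrite /Pg.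
- move=> p _; exists 1 => // s w s' w' _ _ [E _] /=.
  by rewrite /clab -!/(cnode _ _) E.
- move=> f IH /IH [N N0 H]; exists N => // s w s' w' nw nw' E /= nf f'.
  by apply: nf; apply: H f' => //; exact: csim_sym.
- move=> f1 IH1 f2 IH2 /andP[/IH1 [N1 l1 i1] /IH2 [N2 l2 i2]].
  exists (maxn N1 N2); first by lia.
  move=> s w s' w' nw nw' E [f'|f']; [left | right].
    by apply: (invariantW _ i1 nw nw' E f'); lia.
  by apply: (invariantW _ i2 nw nw' E f'); lia.
- move=> n f IH /IH [N N0 H]; exists N.+1 => // s w s' w' nw nw' E.
  case=> l [ul sl Hl]; exists l; split=> // c /Hl [/= lc fc].
  have lc' : c < arity (ctree s') w'.
    by move: lc; rewrite /= -!/(cnode _ _) (csim_arity _ E).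
  split=> //; apply: H fc; rewrite ?cnode_rcons; try exact: node_child.
  exact: csim_child.
- by move=> g [].
- by move=> f IH; split=> // /[dup] nf /IH H; apply: (EI (PState f)).
- move=> g [IH _].
  have H : nofut false (PNeg g) -> Ig (PNeg g).
    move=> /IH [N N0 H]; exists N => // s w s' w' nw nw' E /= nf f'.
    by apply: nf; apply: H f' => //; exact: csim_sym.
  by split=> // ng; apply: EI (H ng).
- move=> g1 [IH1 _] g2 [IH2 _].
  have H : nofut false (POr g1 g2) -> Ig (POr g1 g2).
    move=> /andP[/IH1 I1 /IH2 I2]; have [N N0 [i1 i2]] := common _ _ I1 I2.
    exists N => // s w s' w' nw nw' E [f'|f']; [left | right].
      exact: i1 f'.
    exact: i2 f'.
  by split=> // ng; apply: EI (H ng).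
- move=> g [IH _]; split=> // ng; have [N N0 H] := IH ng.
  exists N.+1 => // s w s' w' nw nw' E.
  case/(ssat_EX _ (bsatP ng)) => _ [c lc bc].
  apply/(ssat_EX _ (bsatP ng)); split=> //.
  have lc' : c < arity (ctree s') w'.
    by move: lc; rewrite /= -!/(cnode _ _) (csim_arity _ E).
  exists c => //; apply: H bc; rewrite ?cnode_rcons; try exact: node_child.
  exact: csim_child.
- by [].
- move=> g1 [IH1 _] g2 [IH2 _]; split=> // /andP[n1 n2].
  have [N N0 [i1 i2]] := common _ _ (IH1 n1) (IH2 n2).
  exists N.+2 => // s w s' w' nw nw' E.
  case/(ssat_EU _ (bsatP n1) (bsatP n2)) => _ r.
  apply/(ssat_EU _ (bsatP n1) (bsatP n2)); split=> //.
  exact: (reach_invariant N0 i1 i2 nw nw' E).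
- move=> g1 [IH1 _] g2 [IH2 _]; split=> // /andP[n1 n2].
  have [N N0 [i1 i2]] := common _ _ (IH1 n1) (IH2 n2).
  exists N.+2 => // s w s' w' nw nw' E.
  case/(ssat_ER _ (bsatP n1) (bsatP n2)) => _ r.
  apply/(ssat_ER _ (bsatP n1) (bsatP n2)); split=> //.
  exact: (release_invariant N0 i1 i2 nw nw' E).
- by [].
Qed.

Definition equal_step : sform AP :=
  SOr (SAnd (SAtom p0) (SE (PY (PState (SAtom p0)))))
      (SAnd (SNeg (SAtom p0)) (SE (PY (PState (SNeg (SAtom p0)))))).

(** No step from the root to the node keeps the colour. The root itself qualifies, as [equal_step]
    fails where there is no predecessor. *)
Definition alternating : sform AP :=
  SNeg (SE (PS (PState (STrue p0)) (PState equal_step))).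

(** [SD 1] is $D^2$, so its negation asks for a single child, which only good sinks have. *)
Definition alternating_sink : sform AP :=
  SE (PU (PState (STrue p0)) (PState (SAnd (SNeg (SD 1 (STrue p0))) alternating))).

Lemma mem_clab s : (p0 \in clab s) = colour s.
Proof. by rewrite /clab; case: (colour s); rewrite ?inE ?eqxx. Qed.

Lemma ssat_equal_step s u : node (ctree s) u ->
  (ssat (ctree s) u equal_step <->
   exists w c, u = rcons w c /\ colour (cnode s u) = colour (cnode s w)).
Proof.
move=> nu; have HY f := ssat_EY u (@PState_node _ (ctree s) f).
rewrite /equal_step ssat_Or !ssat_And !HY /= !mem_clab -!/(cnode _ _); split.
  case=> [[E [_ [w [c [Eu]]]]]|[E [_ [w [c [Eu]]]]]];
    rewrite mem_clab -/(cnode _ _) => E'; exists w, c; split=> //.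
    by rewrite E E'.
  by move/negP/negbTE: E => ->; move/negP/negbTE: E' => ->.
case=> w [c [Eu E]]; case Ecol: (colour (cnode s u)); [left | right].
  split=> //; split=> //; exists w, c; split=> //.
  by rewrite mem_clab -/(cnode _ _) -E.
split=> //; split=> //; exists w, c; split=> //.
by rewrite mem_clab -/(cnode _ _) -E Ecol.
Qed.

Lemma ssat_alternating s u : node (ctree s) u ->
  (ssat (ctree s) u alternating <->
   forall w c, u = rcons w c -> ssat (ctree s) w alternating /\
     colour (cnode s u) = ~~ colour (cnode s w)).
Proof.
pose st := ssat_ES _ (@PState_node _ (ctree s) (STrue p0))
                     (@PState_node _ (ctree s) equal_step).
have altE v : node (ctree s) v -> (ssat (ctree s) v alternating <->
    ~ since (fun v => ssat (ctree s) v (STrue p0))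
            (fun v => ssat (ctree s) v equal_step) v).
  by move=> nv; have := st v; rewrite /alternating /=; tauto.
move=> nu; rewrite altE //; split=> [H w c Eu|H].
  have nw : node (ctree s) w by move: nu; rewrite Eu => /node_rcons [].
  split.
    apply/altE => // Sw; apply: H; rewrite Eu; apply: since_parent => //.
    exact: ssat_True.
  have : ~ ssat (ctree s) u equal_step by move=> e; apply: H; apply: since_here.
  rewrite ssat_equal_step // => H'.
  case E: (colour (cnode s u)); case E': (colour (cnode s w)) => //.
    by case: H'; exists w, c; rewrite E E'.
  by case: H'; exists w, c; rewrite E E'.
case/since_inv => [/ssat_equal_step - /(_ nu) [w [c [Eu E]]]|[_ [w [c [Eu Sw]]]]].
  by have [_] := H _ _ Eu; rewrite E; case: (colour _).
have [] := H _ _ Eu; rewrite altE //.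
by move: nu; rewrite Eu => /node_rcons [].
Qed.

Lemma reach_node t P Q (u : seq nat) :
  @reach AP t P Q u -> node t u -> exists2 v, node t v & Q v.
Proof.
by elim=> [{}u Qu nu|{}u c _ lc _ IH nu]; [exists u | apply: IH; apply: node_child].
Qed.

Lemma alternating_sink_good x d :
  ssat (ctree (CState true x d)) [::] alternating_sink.
Proof.
set s := CState true x d.
apply/(ssat_EU _ (@PState_node _ _ _) (@PState_node _ _ _)); split; first exact: node_root.
have : ssat (ctree s) [::] alternating.
  by apply/ssat_alternating => [|w c]; [exact: node_root | case: w].
have : cnode s [::] = CState true x d by [].
move: [::] (node_root (ctree s)) => w; move: s => s.
elim: d x w => [|d IH] x w nw Ew alt.
  apply: reach_here; apply/ssat_And; split=> // [[l [ul sl Hl]]].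
  suff /(uniq_leq_size ul) : {subset l <= [:: 0]} by rewrite sl.
  by move=> c /Hl [/=]; rewrite -/(cnode _ _) Ew inE /= ltnS leqn0.
(* Move 3 flips the colour and, being odd, keeps a good state good. *)
have l3 : 3 < arity (ctree s) w by rewrite /= -/(cnode _ _) Ew.
apply: (@reach_child _ _ _ _ _ 3) => //; first exact: ssat_True.
have E3 : cnode s (rcons w 3) = CState true (~~ x) d.
  by rewrite cnode_rcons Ew /cstep /= addbT.
apply: (IH (~~ x)) => //; first exact: node_child.
apply/ssat_alternating; first exact: node_child.
by move=> v c /rcons_inj [<- _]; rewrite E3 Ew.
Qed.

Lemma alternating_sink_bad x d :
  ~ ssat (ctree (CState false x d)) [::] alternating_sink.
Proof.
set s := CState false x d.
case/(ssat_EU _ (@PState_node _ _ _) (@PState_node _ _ _)) => nr.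
case/reach_node => // w nw /ssat_And [nD alt].
(* On an alternating path every move flips, and a flip never makes a bad state good; a step from a
   sink repeats the colour, so it is excluded. *)
have Eg : good (cnode s w) = false.
  elim: nw alt {nD} => // {}w c nw IH lc.
  move/(ssat_alternating (node_child nw lc)) => /(_ _ _ erefl) [/IH Ew].
  move: lc; rewrite cnode_rcons /= -/(cnode _ _) /carity /cstep.
  case: (fuel _) => //= d' _; rewrite Ew orFb.
  rewrite [c < 2]ltnNge; case: (1 < c); first by rewrite andbF.
  by rewrite addbF; case: (colour _).
have l1 : 1 < carity (cnode s w).
  by rewrite /carity Eg; case: (fuel _).
apply: nD; exists [:: 0; 1]; split=> // c; rewrite !inE => cl; split.
  by apply: leq_ltn_trans l1; case/orP: cl => /eqP ->.
exact: ssat_True.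
Qed.

End Alternation.

(** * A CTL property that PastCTL± cannot express *)

Section Globally.
Variables (AP : finType) (p0 : AP).

(* Binary trees: [off] counts the steps since the leftmost branch was left if
   [main] holds, and all steps otherwise. *)
Record gstate := GState { main : bool; height : nat; off : nat }.

Definition gstep (s : gstate) (c : nat) : gstate :=
  GState (main s) (height s).+1
    (if [&& main s, off s == 0 & c == 0] then 0 else (off s).+1).

Definition glab (M : nat) (s : gstate) : {set AP} :=
  if off s < M then [set p0] else set0.

Definition groot (b : bool) := GState b 0 0.

Definition gtree M b :=
  unfold gstep (glab M) (fun _ : gstate => isT : 0 < 2) (groot b).

Definition gnode b w := foldl gstep (groot b) w.

Lemma gnode_rcons b w c : gnode b (rcons w c) = gstep (gnode b w) c.
Proof. by rewrite /gnode foldl_rcons. Qed.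

Lemma height_gnode b w : height (gnode b w) = size w.
Proof.
by elim/last_ind: w => // w c IH; rewrite gnode_rcons size_rcons /= IH.
Qed.

Lemma off_gnode b w : off (gnode b w) <= height (gnode b w).
Proof.
elim/last_ind: w => // w c IH; rewrite gnode_rcons /=.
by case: ifP.
Qed.

Definition gchild (s s' : gstate) :=
  height s' = (height s).+1 /\
  (off s' = (off s).+1 \/ off s' = 0 /\ off s = 0).

Lemma gstep_gchild s c : gchild s (gstep s c).
Proof.
split=> //=; case: ifP => [/and3P[_ /eqP -> _]|_]; [by right | by left].
Qed.

(** Height truncated at [K], and signed distance to the frontier [off = M] truncated at [K] on both
    sides. *)
Definition gsim M K (s s' : gstate) :=
  (height s = height s' \/ K <= height s /\ K <= height s') /\
  (off s = off s' \/ off s + K <= M /\ off s' + K <= M \/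
   M + K <= off s /\ M + K <= off s').

Lemma gsim_sym M K s s' : gsim M K s s' -> gsim M K s' s.
Proof. by case=> Hh Ho; split; lia. Qed.

Lemma gsimW M K K' s s' : K <= K' -> gsim M K' s s' -> gsim M K s s'.
Proof. by move=> le [Hh Ho]; split; lia. Qed.

Lemma gsim_gchild M K s s' s1 s1' : 2 * K + 2 < M ->
    gsim M K.+1 s s' -> gchild s s1 -> gchild s' s1' ->
  gsim M K s1 s1'.
Proof. by move=> lM [Hh Ho] [h1 o1] [h1' o1']; split; lia. Qed.

Lemma gsim_parent M K s s' s1 s1' : 2 * K + 2 < M ->
    gsim M K.+1 s s' -> gchild s1 s -> gchild s1' s' ->
  gsim M K s1 s1'.
Proof. by move=> lM [Hh Ho] [h1 o1] [h1' o1']; split; lia. Qed.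

(** Since [off <= height] and [2 * K < M], a node of height at most [K] lies deep inside the
    frontier, so height class and offset class do not change in the same step. Two nodes that both
    change class change it alike; otherwise one of them stutters. *)
Lemma gsim_parent_stutter M K s s' s1 s1' : 2 * K < M ->
    off s <= height s -> off s' <= height s' ->
    gsim M K s s' -> gchild s1 s -> gchild s1' s' ->
  gsim M K s1 s' \/ gsim M K s s1' \/ gsim M K s1 s1'.
Proof.
move=> lM l l' [Hh Ho] [h1 o1] [h1' o1']; rewrite /gsim.
by case: Hh => Hh; case: Ho => [Ho|[Ho|Ho]]; case: o1 => o1; case: o1' => o1';
  lia.
Qed.

(** In the third case the primed node is too deep inside the frontier and moves on alone, which
    [off s' < M] allows only finitely often, as its child has a larger [off]. *)
Lemma gsim_child_stutter M K s s' s1 s1' : 2 * K < M ->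
    off s <= height s -> off s' <= height s' ->
    gsim M K s s' -> gchild s s1 -> gchild s' s1' -> off s1' = (off s').+1 ->
  gsim M K s1 s' \/ gsim M K s1 s1' \/ (gsim M K s s1' /\ off s' < M).
Proof.
move=> lM l l' [Hh Ho] [h1 o1] [h1' _] o1'; rewrite /gsim.
by case: Hh => Hh; case: Ho => [Ho|[Ho|Ho]]; case: o1 => o1; lia.
Qed.

Definition ginvariant M K (P : bool -> seq nat -> Prop) :=
  forall b w b' w', node (gtree M b) w -> node (gtree M b') w' ->
    gsim M K (gnode b w) (gnode b' w') -> P b w -> P b' w'.

Lemma ginvariantW M K K' P :
  K <= K' -> ginvariant M K P -> ginvariant M K' P.
Proof. by move=> le iP b w b' w' n n' /(gsimW le); apply: iP. Qed.

Lemma gnode_gchild b w c : gchild (gnode b w) (gnode b (rcons w c)).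
Proof. by rewrite gnode_rcons; exact: gstep_gchild. Qed.

Lemma gsim_rcons M K b w c b' w' : 0 < K ->
    gsim M K (gnode b (rcons w c)) (gnode b' w') ->
  exists v d, w' = rcons v d.
Proof.
move=> K0 []; rewrite !height_gnode size_rcons => H _.
by case/lastP: w' H => [/= H|v d _]; [exfalso; lia | exists v, d].
Qed.

(* Without [Y] the operator [S] is insensitive to stuttering, so only the
   sequence of distinct classes met on the way to the root matters. *)
Lemma since_ginvariant M K (P Q : bool -> seq nat -> Prop) :
    0 < K -> 2 * K < M -> ginvariant M K P -> ginvariant M K Q ->
  ginvariant M K (fun b => since (P b) (Q b)).
Proof.
move=> K0 lM iP iQ b w b' w'; have [n] := ubnP (size w + size w').
elim: n w w' => // n IH w w' ln nw nw' E Sw.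
case/since_inv: (Sw) => [Qw|[Pw [v [c [Ew Sv]]]]].
  by apply: since_here; apply: iQ Qw.
have Pw' : P b' w' by apply: iP Pw.
subst w; have [v' [c' Ew']] := gsim_rcons K0 E; subst w'.
have [nv _] := node_rcons nw; have [nv' _] := node_rcons nw'.
move: ln; rewrite !size_rcons addSn addnS !ltnS => ln.
have [H|[H|H]] := gsim_parent_stutter lM (off_gnode _ _) (off_gnode _ _) E
  (gnode_gchild _ _ _) (gnode_gchild _ _ _).
- by apply: (IH v) => //; rewrite size_rcons addnS; lia.
- apply: since_parent => //; apply: (IH (rcons v c)) => //.
  by rewrite size_rcons addSn; lia.
- by apply: since_parent => //; apply: (IH v) => //; lia.
Qed.

Lemma reach_ginvariant M K (P Q : bool -> seq nat -> Prop) :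
    2 * K < M -> ginvariant M K P -> ginvariant M K Q ->
  ginvariant M K (fun b => reach (gtree M b) (P b) (Q b)).
Proof.
move=> lM iP iQ b w b' w' nw nw' E H.
elim: H w' nw nw' E => {w} [w Qw|w c Pw lc _ IH] w' nw nw' E.
  by apply: reach_here; apply: iQ Qw.
have nwc : node (gtree M b) (rcons w c) by apply: node_child.
(* The imitating path always takes child 1, which increases [off] even on the leftmost branch, so it
   gets to the frontier while the original path waits. *)
have [n] := ubnP (M - off (gnode b' w')).
elim: n w' nw' E => // n IHn w' nw' E ln.
have Pw' : P b' w' by apply: iP Pw.
have nw1 : node (gtree M b') (rcons w' 1) by apply: node_child.
have o1 : off (gnode b' (rcons w' 1)) = (off (gnode b' w')).+1.
  by rewrite gnode_rcons /= !andbF.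
have [H|[H|[H lo]]] := gsim_child_stutter lM (off_gnode _ _) (off_gnode _ _) E
  (gnode_gchild _ _ c) (gnode_gchild _ _ _) o1.
- exact: IH.
- by apply: (@reach_child _ _ _ _ _ 1) => //; apply: IH.
- by apply: (@reach_child _ _ _ _ _ 1) => //; apply: IHn => //; rewrite o1; lia.
Qed.

(** [K] depends on the formula only, and [M] is chosen afterwards. One-step operators cost one unit
    of [K]; until and since cost none, as they do not see stuttering. *)
Lemma pastctlpm_ginvariant (f : sform AP) : PastCTLpm f ->
  exists2 K, 0 < K & forall M, 2 * K < M ->
    ginvariant M K (fun b w => ssat (gtree M b) w f).
Proof.
elim/ctlpm_ind: f / => [p|f [K K0 IH]|f1 f2 [K1 K10 IH1] [K2 K20 IH2]
  |n f [K K0 IH]|f [K K0 IH]|f1 f2 [K1 K10 IH1] [K2 K20 IH2]|f _ [K K0 IH]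
  |f1 f2 _ [K1 K10 IH1] [K2 K20 IH2]].
- exists 1 => // M lM b w b' w' _ _ [_ E] /=; rewrite -!/(gnode _ _) /glab.
  by have -> : (off (gnode b w) < M) = (off (gnode b' w') < M) by lia.
- exists K => // M lM b w b' w' nw nw' E /= nf f'.
  by apply: nf; apply: IH f' => //; exact: gsim_sym.
- exists (maxn K1 K2) => [|M lM]; first by lia.
  move=> b w b' w' nw nw' E [f'|f']; [left | right].
    by apply: (ginvariantW _ (IH1 _ _) nw nw' E f'); lia.
  by apply: (ginvariantW _ (IH2 _ _) nw nw' E f'); lia.
- exists K.+1 => // M lM b w b' w' nw nw' E.
  (* Any child of [w] is similar to any child of [w'], so the same indices serve. *)
  case=> l [ul sl Hl]; exists l; split=> // c /Hl [/= lc fc]; split=> //.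
  apply: (IH M) fc; try exact: node_child; first by lia.
  by apply: (gsim_gchild _ E); [lia | exact: gnode_gchild | exact: gnode_gchild].
- exists K.+1 => // M lM b w b' w' nw nw' E.
  case/(ssat_EX _ (@PState_node _ _ _)) => _ [c lc fc].
  apply/(ssat_EX _ (@PState_node _ _ _)); split=> //; exists c => //.
  apply: (IH M) fc; try exact: node_child; first by lia.
  by apply: (gsim_gchild _ E); [lia | exact: gnode_gchild | exact: gnode_gchild].
- exists (maxn K1 K2) => [|M lM]; first by lia.
  have i1 : ginvariant M (maxn K1 K2) (fun b w => ssat (gtree M b) w f1).
    by apply: (ginvariantW _ (IH1 _ _)); lia.
  have i2 : ginvariant M (maxn K1 K2) (fun b w => ssat (gtree M b) w f2).
    by apply: (ginvariantW _ (IH2 _ _)); lia.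
  move=> b w b' w' nw nw' E.
  case/(ssat_EU _ (@PState_node _ _ _) (@PState_node _ _ _)) => _ r.
  apply/(ssat_EU _ (@PState_node _ _ _) (@PState_node _ _ _)); split=> //.
  exact: (reach_ginvariant lM i1 i2 nw nw' E).
- exists K.+1 => // M lM b w b' w' nw nw' E.
  case/(ssat_EY _ (@PState_node _ _ _)) => _ [v [c [Ew fv]]]; subst w.
  have [v' [c' Ew']] := gsim_rcons (ltn0Sn K) E; subst w'.
  apply/(ssat_EY _ (@PState_node _ _ _)); split=> //; exists v', c'; split=> //.
  have [nv _] := node_rcons nw; have [nv' _] := node_rcons nw'.
  apply: (IH M) fv => //; first by lia.
  by apply: (gsim_parent _ E); [lia | exact: gnode_gchild | exact: gnode_gchild].
- exists (maxn K1 K2) => [|M lM]; first by lia.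
  have i1 : ginvariant M (maxn K1 K2) (fun b w => ssat (gtree M b) w f1).
    by apply: (ginvariantW _ (IH1 _ _)); lia.
  have i2 : ginvariant M (maxn K1 K2) (fun b w => ssat (gtree M b) w f2).
    by apply: (ginvariantW _ (IH2 _ _)); lia.
  move=> b w b' w' nw nw' E.
  case/(ssat_ES _ (@PState_node _ _ _) (@PState_node _ _ _)) => _ r.
  apply/(ssat_ES _ (@PState_node _ _ _) (@PState_node _ _ _)); split=> //.
  by apply: (since_ginvariant _ lM i1 i2 nw nw' E) => //; lia.
Qed.

(** EG [p0] in the form $E(\bot\,R\,p_0)$. *)
Definition EG : sform AP :=
  SE (PR (PState (SNeg (STrue p0))) (PState (SAtom p0))).

Lemma EG_main M : 0 < M -> ssat (gtree M true) [::] EG.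
Proof.
move=> M0; exists (fun i => nseq i 0); split.
  split=> // i; exists 0 => //.
  by elim: i => //= i ->.
exists 0; split=> //=; left=> j _; rewrite -/(gnode _ _) /glab.
have -> : off (gnode true (nseq j 0)) = 0.
  suff -> : gnode true (nseq j 0) = GState true j 0 by [].
  by elim: j => // j IH; rewrite -addn1 nseqD cats1 gnode_rcons IH /= addn1.
by rewrite M0 inE.
Qed.

(** Here [off] is the depth, so every path loses [p0] at depth [M]. *)
Lemma EG_off M : ~ ssat (gtree M false) [::] EG.
Proof.
case=> pi [rp [i [_ /= H]]].
case: H => [|[j _ [[]]]]; last exact: classic.
move/(_ (maxn i M)); rewrite -/(gnode _ _) /glab.
have -> : off (gnode false (pi (maxn i M))) = maxn i M.
  rewrite -{2}(root_path_size (maxn i M) rp).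
  suff -> w : gnode false w = GState false (size w) (size w) by [].
  by elim/last_ind: w => // w c IH; rewrite gnode_rcons size_rcons IH.
by rewrite ltnNge leq_maxr inE leq_maxl => /(_ isT).
Qed.

End Globally.

(** * The comparisons, from the two separating formulae *)

Theorem theorem3p2 (AP : finType) (p0 : AP) :
  (forall f : sform AP, CTLpm f -> PastCTLpm f) /\
  (forall f : sform AP, PastCTLpm f -> PastCTL f) /\
  strictly_less (@CTLpm AP) (@PastCTLpm AP) /\
  incomparable (@PastCTLpm AP) (@CTL AP) /\
  strictly_less (@PastCTLpm AP) (@PastCTL AP).
Proof.
have alt_not_CTL f : CTL f -> ~ init_equiv f (alternating_sink p0).
  move=> /(ctl_invariant p0) [N _ iN] eqf.
  (* The two roots share colour and fuel [N], hence are similar, although only one is good. *)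
  apply: (@alternating_sink_bad AP p0 true N); apply/eqf.
  apply: (iN (CState true true N) [::]); try exact: node_root.
    by split=> //; left.
  by apply/eqf; exact: alternating_sink_good.
have EG_not_PastCTLpm f : PastCTLpm f -> ~ init_equiv f (EG p0).
  move=> /(pastctlpm_ginvariant p0) [K _ iK] eqf.
  (* Both roots have height and offset 0, so they are similar for every [K]. *)
  apply: (@EG_off AP p0 (2 * K).+1); apply/eqf.
  apply: (iK _ (ltnSn _) true [::]); try exact: node_root.
    by split; left.
  by apply/eqf; exact: EG_main.
have init_sym (f g : sform AP) : init_equiv f g -> init_equiv g f.
  by move=> E t; split; [move/(proj2 (E t)) | move/(proj1 (E t))].
split; first exact: ctlpm_past.
split; first exact: ctlpm_pctl.
split.
  split; first by exists id => f /ctlpm_past.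
  (* Every CTL± formula is a CTL formula, so inexpressibility in CTL suffices here. *)
  exists (alternating_sink p0); split=> // f /ctlpm_pctl; exact: alt_not_CTL.
split.
  split.
    exists (alternating_sink p0); split=> // g Cg /init_sym; exact: alt_not_CTL.
  exists (EG p0); split=> // f Pf /init_sym; exact: EG_not_PastCTLpm.
split; first by exists id => f /ctlpm_pctl.
by exists (EG p0); split=> // f; exact: EG_not_PastCTLpm.
Qed.
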